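(* Let $k$ be a prime and let $f(x)=\sum_{i=0}^{k-1}a_ix^i\in\mathbb{Z}[x]$. Write $A^{+}=\sum_{j=0}^{k-1}\max\{0,a_j\}$, $A^{-}=\sum_{j=0}^{k-1}\max\{0,-a_j\}$, and $A=\max\{A^+,A^-\}$. Let $N$ denote the absolute norm of $\mathbb{Q}(\zeta_k)$. (a) If $\sum_{i=0}^{k-1}a_i=0$, then $$|N(f(\zeta_k))|\le kA^{k-1}.$$ (b) If $\sum_{i=0}^{k-1}a_i\ne 0$, then $$|N(f(\zeta_k))|\le\frac{A^k}{\left|\sum_{i=0}^{k-1}a_i\right|}.$$
   Context: $\zeta_k$ is a complex primitive $k$th root of unity. The absolute norm of $\mathbb{Q}(\zeta_k)$ is the field norm from $\mathbb{Q}(\zeta_k)$ to $\mathbb{Q}$. *)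

(* Defs.v *)
From HB Require Import structures.
From mathcomp Require Import all_boot all_order all_algebra all_fingroup all_field.

Set Implicit Arguments.
Unset Strict Implicit.
Unset Printing Implicit Defensive.

Import Order.TTheory GRing.Theory Num.Theory.
Local Open Scope ring_scope.

(* [galNorm] takes its values in the number field itself.  For E Galois over Q
   and x in E the value lies in Q (the line 1%VS), and [absNorm E x] is the
   corresponding rational number: see [absNormE]. *)
Definition absNorm (L : splittingFieldType rat) (E : {vspace L}) (x : L) : rat :=
  coord [tuple (1 : L)] ord0 (galNorm 1%VS E x).

Lemma absNormE (L : splittingFieldType rat) (E : {subfield L}) (x : L) :
  galois 1%VS E -> x \in E -> (absNorm E x)%:A = galNorm 1%VS E x.
Proof.
move=> /galois_fixedField fixE xE.
have := @galNorm_fixedField _ _ 1%AS E x xE; rewrite fixE => /vlineP[r normE].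
rewrite /absNorm normE linearZ /=.
have /coord_free-/(_ ord0 ord0) /= -> : free [tuple (1 : L)].
  by rewrite seq1_free oner_eq0.
by rewrite mulr1.
Qed.

Definition posSum (k : nat) (f : {poly int}) : int :=
  \sum_(j < k) Num.max 0 f`_j.

Definition negSum (k : nat) (f : {poly int}) : int :=
  \sum_(j < k) Num.max 0 (- f`_j).

Definition maxSum (k : nat) (f : {poly int}) : int :=
  Num.max (posSum k f) (negSum k f).

(* Main.v *)
Require Import Defs.
From HB Require Import structures.
From mathcomp Require Import all_boot all_order all_algebra all_fingroup all_field.
From mathcomp Require Import lra.

Set Implicit Arguments.
Unset Strict Implicit.
Unset Printing Implicit Defensive.

Import Order.TTheory GRing.Theory Num.Theory.
Local Open Scope ring_scope.

(** The circulant matrix C of the coefficients of f is diagonalized by the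
Fourier matrix of the powers of zeta, with eigenvalues f(zeta^j) for
0 <= j < k.  For k prime the norm of f(zeta) is the product of these
eigenvalues over j <> 0, because the conjugates of zeta are exactly the zeta^j
with j prime to k.  The remaining eigenvalue is f(1) = S, so det C = S * N
([det_circulant_sum]).

This says nothing about N when S = 0.  Replacing the first row of C by ones
gives a matrix C' with det C' = N, whatever S is ([det_circulant_row1]): every
column sum of the Fourier matrix except the first vanishes, so this replacement
removes precisely the eigenvalue S.

Both bounds then follow from Schinzel's determinant inequality
([norm_det_le_rowBound]): a real determinant is at most the product over the
rows of the larger of the sum of the positive entries and the sum of the
absolute values of the negative entries.  For each row of C this quantity is A,
so |S * N| <= A^k; for the row of ones it is k, so |N| <= k * A^(k-1).

Schinzel's inequality is proved by induction on the size, expanding along the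
first row.  By induction each first-row cofactor is bounded by the product B for
the other rows, and so is each difference of two cofactors, since it is, up to
sign, the determinant obtained by adding one column to another and deleting the
former.  Hence all cofactors, together with 0, lie in an interval of length B,
and a combination of them with coefficients v is at most B times the larger of
the positive and negative masses of v ([norm_sum_rowBound]). *)

(** * Schinzel's determinant inequality *)

Definition posPart (R : realDomainType) n (v : 'I_n -> R) : R :=
  \sum_j Num.max 0 (v j).

Definition rowBound (R : realDomainType) n (v : 'I_n -> R) : R :=
  Num.max (posPart v) (posPart (fun j => - v j)).

Lemma eq_rowBound (R : realDomainType) n (v w : 'I_n -> R) :
  v =1 w -> rowBound v = rowBound w.
Proof.
by move=> vw; congr Num.max; apply: eq_bigr => j _; rewrite vw.
Qed.

Lemma rowBound_ge0 (R : realDomainType) n (v : 'I_n -> R) : 0 <= rowBound v.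
Proof. by rewrite le_max sumr_ge0 // => j _; rewrite le_max lexx. Qed.

(** The values [c j] and 0 lie in an interval [lo, hi] of length at most [B], so
the sum is at most [posPart v * hi + posPart (- v) * (- lo)]. *)
Lemma ler_sum_rowBound (R : realDomainType) n (v c : 'I_n -> R) (B : R) :
    (forall j, `|c j| <= B) -> (forall a b, a != b -> c a - c b <= B) ->
  \sum_j v j * c j <= rowBound v * B.
Proof.
case: n v c => [|n] v c cB cabB.
  by rewrite big_ord0 /rowBound /posPart !big_ord0 maxxx mul0r.
have B0 : 0 <= B by apply: le_trans (cB ord0).
(* Starting both extrema at 0 puts 0 in the interval. *)
pose hi := \big[Num.max/0]_j c j; pose lo := \big[Num.min/0]_j c j.
have hi0 : 0 <= hi by rewrite /hi bigmax_idl le_max lexx.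
have lo0 : lo <= 0 by rewrite /lo bigmin_idl ge_min lexx.
have hiB : hi <= B + lo.
  rewrite -lerBlDl; apply: le_bigmin => [|b _]; rewrite lerBlDl.
    rewrite addr0; apply: bigmax_le => // a _.
    exact: le_trans (ler_norm _) (cB a).
  apply: bigmax_le => [|a _].
    by have := cB b; rewrite ler_norml => /andP[? _]; lra.
  have [->|ab] := eqVneq a b; first by rewrite lerDr.
  by rewrite -lerBlDr cabB.
have vE j : v j * c j <= Num.max 0 (v j) * hi - Num.max 0 (- v j) * lo.
  have chi : c j <= hi by apply: le_bigmax.
  have clo : lo <= c j by apply: bigmin_le.
  have [v0|v0] := leP 0 (v j).
    by rewrite max_l ?oppr_le0 // mul0r subr0 ler_wpM2l.
  have {}v0 := ltW v0.
  by rewrite max_r ?oppr_ge0 // mul0r sub0r mulNr opprK ler_wnM2l.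
apply: le_trans (ler_sum _ (fun j _ => vE j)) _.
rewrite sumrB -!mulr_suml -/(posPart v) -/(posPart (fun j => - v j)).
have p1 : posPart v <= rowBound v by rewrite le_max lexx.
have p2 : posPart (fun j => - v j) <= rowBound v by rewrite le_max lexx orbT.
have := rowBound_ge0 v; nra.
Qed.

Lemma norm_sum_rowBound (R : realDomainType) n (v c : 'I_n -> R) (B : R) :
    (forall j, `|c j| <= B) -> (forall a b, a != b -> `|c a - c b| <= B) ->
  `|\sum_j v j * c j| <= rowBound v * B.
Proof.
move=> cB cabB; rewrite ler_norml lerNl -sumrN; apply/andP; split.
  under eq_bigr do rewrite -mulrN.
  apply: ler_sum_rowBound => [j|a b ab]; first by rewrite normrN.
  by apply: le_trans (ler_norm _) _; rewrite -opprD normrN cabB.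
by apply: ler_sum_rowBound => // a b /cabB; apply: le_trans (ler_norm _).
Qed.

Lemma rowBound_lift (R : realDomainType) n (v : 'I_n.+1 -> R) a :
  rowBound (fun j => v (lift a j)) <= rowBound v.
Proof.
have posPart_lift (w : 'I_n.+1 -> R) :
    posPart (fun j => w (lift a j)) <= posPart w.
  by rewrite /posPart (bigD1_ord a) //= lerDr le_max lexx.
by rewrite ge_max !le_max posPart_lift (posPart_lift (fun j => - v j)) orbT.
Qed.

(** Merging the entries [a] and [b] of a row can only cancel mass, because the
positive part of a sum is at most the sum of the positive parts. *)
Lemma rowBound_merge (R : realDomainType) n (v : 'I_n.+1 -> R) a b :
    a != b ->
  rowBound (fun j => v (lift a j) + (lift a j == b)%:R * v a) <= rowBound v.
Proof.
move=> ab; have posPart_merge (w : 'I_n.+1 -> R) :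
    posPart (fun j => w (lift a j) + (lift a j == b)%:R * w a) <= posPart w.
  have [j0 bE] : exists j0, b = lift a j0.
    by case: (unliftP a b) ab => [j -> _|->]; [exists j | rewrite eqxx].
  rewrite [leRHS]/posPart (bigD1_ord a) //= addrC.
  have -> : Num.max 0 (w a) = \sum_(j < n) (lift a j == b)%:R * Num.max 0 (w a).
    rewrite (bigD1 j0) //= bE eqxx mul1r big1 ?addr0 // => j jj0.
    by rewrite (inj_eq lift_inj) (negPf jj0) mul0r.
  rewrite -big_split; apply: ler_sum => j _ /=.
  case: eqP => _; rewrite ?mul1r ?mul0r ?addr0 // ge_max.
  by rewrite addr_ge0 ?lerD // le_max lexx // orbT.
rewrite ge_max !le_max posPart_merge /=; apply/orP; right.
rewrite (le_trans _ (posPart_merge (fun j => - v j))) //.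
by apply: ler_sum => j _; rewrite opprD mulrN.
Qed.

Definition setRow0 (R : Type) n (u : 'I_n.+1 -> R) (M : 'M[R]_n.+1) :=
  \matrix_(i, j) if i == ord0 then u j else M i j.

Lemma cofactor_setRow0 (R : comPzRingType) n (u : 'I_n.+1 -> R) M j :
  cofactor (setRow0 u M) ord0 j = cofactor M ord0 j.
Proof.
by congr (_ * \det _); apply/matrixP => i l; rewrite !mxE.
Qed.

(** The determinant as a linear form in the first row. *)
Lemma det_setRow0 (R : comPzRingType) n (u : 'I_n.+1 -> R) (M : 'M[R]_n.+1) :
  \det (setRow0 u M) = \sum_j u j * cofactor M ord0 j.
Proof.
rewrite (expand_det_row _ ord0); apply: eq_bigr => j _.
by rewrite cofactor_setRow0 mxE eqxx.
Qed.

(** The matrix is unitriangular, upper or lower according to the order of [a] and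
[b]. *)
Lemma det_transvection (R : comPzRingType) n (a b : 'I_n) :
  a != b -> \det (1%:M + delta_mx a b : 'M[R]_n) = 1.
Proof.
have trig (i j : 'I_n) : (j < i)%N -> \det (1%:M + delta_mx i j : 'M[R]_n) = 1.
  move=> ji; rewrite det_trig.
    apply: big1 => l _; rewrite !mxE eqxx.
    case: eqP => [->|_]; last by rewrite addr0.
    by rewrite -val_eqE (gtn_eqF ji) addr0.
  apply/is_trig_mxP => l m lm; rewrite !mxE.
  rewrite -[l == m]val_eqE (ltn_eqF lm) add0r.
  case: eqP => [le|//]; case: eqP => [me|//].
  by move: lm; rewrite le me ltnNge ltnW.
rewrite -val_eqE neq_ltn => /orP[ab|]; last exact: trig.
by rewrite -det_tr linearD /= tr_scalar_mx trmx_delta trig.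
Qed.

Lemma mulmx_transvection (R : pzRingType) m n (M : 'M[R]_(m, n)) a b i j :
  (M *m (1%:M + delta_mx a b)) i j = M i j + (j == b)%:R * M i a.
Proof.
rewrite mulmxDr mulmx1 mxE; congr (_ + _); rewrite mxE (bigD1 a) //= big1.
  by rewrite mxE eqxx /= addr0; case: eqP; rewrite ?mulr1 ?mul1r ?mulr0 ?mul0r.
by move=> l la; rewrite mxE (negPf la) mulr0.
Qed.

(** The difference is the determinant of [M] with first row [e_a - e_b].  Adding
column [a] to column [b] turns that row into [e_a] and preserves the
determinant, which is then a single cofactor. *)
Lemma cofactorB (R : comPzRingType) n (M : 'M[R]_n.+1) a b : a != b ->
  cofactor M ord0 a - cofactor M ord0 b
    = cofactor (M *m (1%:M + delta_mx a b)) ord0 a.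
Proof.
move=> ab.
have cofE (N : 'M[R]_n.+1) c :
    cofactor N ord0 c = \det (setRow0 (fun j => (j == c)%:R) N).
  rewrite det_setRow0 (bigD1 c) //= eqxx mul1r big1 ?addr0 // => j /negPf->.
  by rewrite mul0r.
transitivity (
    \det (setRow0 (fun j => (j == a)%:R - (j == b)%:R) M)).
  by rewrite !cofE !det_setRow0 -sumrB; apply: eq_bigr => j _; rewrite mulrBl.
rewrite cofE -[LHS]mulr1 -[X in _ * X = _](det_transvection R ab) -det_mulmx.
congr (\det _).
apply/matrixP => i j; rewrite mulmx_transvection ![setRow0 _ _ _ _]mxE.
case: (i == ord0); last by rewrite mulmx_transvection.
by rewrite eqxx (negPf ab) subr0 mulr1 subrK.
Qed.

(** The induction hypothesis is applied to the minors for the first row, both of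
[M] itself and of [M] with two columns merged. *)
Lemma norm_det_le_rowBound (R : realDomainType) n (M : 'M[R]_n) :
  `|\det M| <= \prod_i rowBound (M i).
Proof.
elim: n M => [|n IHn] M; first by rewrite det_mx00 big_ord0 normr1.
have cof_le (N : 'M[R]_n.+1) a :
    (forall i, rowBound (fun j => N (lift ord0 i) (lift a j))
               <= rowBound (M (lift ord0 i))) ->
  `|cofactor N ord0 a| <= \prod_i rowBound (M (lift ord0 i)).
  move=> NM; rewrite normrM normrX normrN1 expr1n mul1r.
  apply: le_trans (IHn _) _; apply: ler_prod => i _; rewrite rowBound_ge0 /=.
  by apply: le_trans (NM i); under eq_rowBound do rewrite !mxE.
rewrite (expand_det_row _ ord0) [leRHS]big_ord_recl.
apply: norm_sum_rowBound => [a|a b ab].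
  by apply: cof_le => i; apply: rowBound_lift.
rewrite cofactorB //; apply: cof_le => i.
rewrite (eq_rowBound (fun j => mulmx_transvection _ _ _ _ _)).
exact: rowBound_merge.
Qed.

(** * Conjugates of a root of unity *)

(** The polynomial X^n - 1 is the product of the 'Phi_d with d dividing n, and a
root of 'Phi_d has order dividing d. *)
Lemma root_Cyclotomic (F : fieldType) n (z : F) :
  n.-primitive_root z -> root (map_poly intr 'Phi_n) z.
Proof.
move=> prim_z; have n_gt0 := prim_order_gt0 prim_z.
have Xn1 d : (d > 0)%N ->
    \prod_(e <- divisors d) map_poly intr 'Phi_e = 'X^d - 1 :> {poly F}.
  move=> d_gt0; rewrite -rmorph_prod prod_Cyclotomic //.
  by rewrite rmorphB rmorph1 /= map_polyXn.
have : root (\prod_(e <- divisors n) map_poly intr 'Phi_e) z.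
  by rewrite Xn1 // rootE !hornerE prim_expr_order // subrr.
rewrite rootE horner_prod prodf_seq_eq0 => /hasP[d /[swap] /= dz].
rewrite -dvdn_divisors // => d_n.
have d_gt0 := dvdn_gt0 n_gt0 d_n.
suff : (n %| d)%N by move=> n_d; have /eqP <- : d == n by rewrite eqn_dvd d_n.
rewrite (prim_order_dvd prim_z) -subr_eq0.
have : root ('X^d - 1) z.
  rewrite -Xn1 // rootE horner_prod prodf_seq_eq0; apply/hasP; exists d => //.
  by rewrite -dvdn_divisors.
by rewrite rootE !hornerE.
Qed.

(** Irreducibility of 'Phi_n over the rationals is known through the minimal
polynomials of algebraic complex numbers.  It transfers to [L] because both the
complex minimal polynomial of a root of unity and that of [z] over the line
[1%VS] come from polynomials with rational coefficients, where divisibility can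
be compared. *)
Lemma adjoin_degree_prim_root (L : fieldExtType rat) n (z : L) :
  n.-primitive_root z -> adjoin_degree 1%VS z = totient n.
Proof.
move=> prim_z; have n_gt0 := prim_order_gt0 prim_z.
have [w prim_w] := C_prim_root_exists n_gt0.
have [q [minw q_monic] q_dvd] := minCpolyP w.
have size_q : size q = (totient n).+1.
  by rewrite -(size_cyclotomic w) -(minCpoly_cyclotomic prim_w) minw size_map_poly.
have qE : q = map_poly intr 'Phi_n.
  apply: (map_poly_inj (ratr : rat -> algC)).
  rewrite -minw (minCpoly_cyclotomic prim_w) -(Cintr_Cyclotomic prim_w) -map_poly_comp.
  by apply: eq_map_poly => a /=; rewrite rmorph_int.
have q0 : q != 0 by apply: monic_neq0.
have /polyOver1P[p pE] := minPolyOver 1 z.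
have size_p : size p = (adjoin_degree 1 z).+1.
  by rewrite -(size_map_poly (in_alg L)) -pE size_minPoly.
have : p %| q.
  rewrite -(dvdp_map (in_alg L)) -pE minPoly_dvdp //.
    by apply/polyOver1P; exists q.
  have -> : map_poly (in_alg L) q = map_poly intr 'Phi_n.
    by rewrite qE -map_poly_comp; apply: eq_map_poly => a /=; rewrite scaler_int.
  exact: root_Cyclotomic.
case/dvdpP=> s sE.
apply/eqP; rewrite -eqSS -size_p -size_q.
have s0 : s != 0 by apply: contraNneq q0 => s0; rewrite sE s0 mul0r.
have p0 : p != 0 by apply: contraNneq q0 => p0; rewrite sE p0 mulr0.
(* w is a root of s or p, so its minimal polynomial q divides s or p. *)
have : root (map_poly ratr q) w by rewrite q_dvd.
rewrite sE rmorphM rootM /= !q_dvd => /orP[q_s|q_p].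
  have := dvdp_leq s0 q_s; rewrite sE size_mul // size_p addnS /=.
  by rewrite -[leqRHS]addn0 leq_add2l leqn0 /adjoin_degree.
by rewrite eqn_leq -sE !dvdp_leq // sE dvdp_mull.
Qed.

(** The field generated by [z] is the splitting field of the separable polynomial
X^n - 1. *)
Lemma galois_prim_root (L : splittingFieldType rat) n (z : L) :
  n.-primitive_root z -> galois 1%VS <<1; z>>%VS.
Proof.
move=> prim_z; have n_gt0 := prim_order_gt0 prim_z.
apply/splitting_galoisField; exists ('X^n - 1); split.
- by rewrite rpredB ?rpredX ?polyOverX ?rpred1.
- apply: separable_Xn_sub_1.
  by rewrite -(rmorph_nat (in_alg L)) fmorph_eq0 pnatr_eq0 -lt0n.
exists [seq z ^+ i | i <- index_iota 0 n].
  by rewrite big_map (factor_Xn_sub_1 prim_z) eqpxx.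
apply/eqP; rewrite eqEsubv; apply/andP; split.
  apply/Fadjoin_seqP; split; first exact: subv_adjoin.
  by move=> _ /mapP[i _ ->]; rewrite rpredX ?memv_adjoin.
apply/FadjoinP; split; first exact: subv_adjoin_seq.
(* For n = 1 the list of powers is [:: 1], which does not list z as z ^+ 1. *)
have [n1|n_neq1] := eqVneq n 1%N.
  move: prim_z; rewrite n1 => /prim_expr_order; rewrite expr1 => ->.
  exact: mem1v.
rewrite seqv_sub_adjoin //; apply/mapP; exists 1%N => //.
by rewrite mem_index_iota ltn_neqAle eq_sym n_neq1.
Qed.

(** An automorphism is determined by the exponent [e s] with [s z = z ^+ e s],
which is prime to n; by the degree computation every such exponent occurs. *)
Lemma galNorm_prim_root (L : splittingFieldType rat) n (z : L) (p : {poly L}) :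
    n.-primitive_root z -> p \is a polyOver 1%VS ->
  galNorm 1%VS <<1; z>>%VS p.[z] = \prod_(j < n | coprime j n) p.[z ^+ j].
Proof.
move=> prim_z p1; have n_gt0 := prim_order_gt0 prim_z.
set E := <<1; z>>%VS.
have galE : galois 1%VS E by apply: galois_prim_root prim_z.
have sz_expn (s : gal_of E) : (s z) ^+ n = 1.
  by rewrite -rmorphXn (prim_expr_order prim_z) rmorph1.
pose e (s : gal_of E) : 'I_n := sval (prim_rootP prim_z (sz_expn s)).
have eE (s : gal_of E) : s z = z ^+ e s by rewrite /e; case: prim_rootP.
have e_inj : {in 'Gal(E / 1%VS)%g &, injective e}.
  by move=> s t Gs Gt est; apply/eqP; rewrite gal_adjoin_eq // !eE est.
have eG : e @: 'Gal(E / 1%VS)%g = [set j : 'I_n | coprime j n].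
  apply/eqP; rewrite eqEcard; apply/andP; split.
    apply/subsetP => _ /imsetP[s _ ->]; rewrite inE.
    by rewrite -(prim_root_exp_coprime _ prim_z) -eE fmorph_primitive_root.
  rewrite card_in_imset // -galois_dim // -adjoin_degreeE.
  rewrite (adjoin_degree_prim_root prim_z) totient_count_coprime big_mkord.
  rewrite -sum1_card big_mkcond leq_sum // => j _.
  by rewrite inE coprime_sym; case: coprime.
rewrite /galNorm (eq_bigr (fun s : gal_of E => p.[z ^+ e s])) => [|s Gs].
  rewrite -(big_imset (fun j : 'I_n => p.[z ^+ j])) // eG.
  by apply: eq_bigl => j; rewrite inE.
rewrite -eE -[in LHS]horner_map /= (fixedPoly_gal _ Gs) //.
exact: subv_adjoin.
Qed.

(** * Circulant determinants *)

(** The difference [j - i] is taken in the cyclic group ['I_n.+1]. *)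
Definition circulant (R : Type) n (c : 'I_n.+1 -> R) : 'M[R]_n.+1 :=
  \matrix_(i, j) c (j - i).

Lemma map_circulant (R S : Type) (h : R -> S) n (c : 'I_n.+1 -> R) :
  map_mx h (circulant c) = circulant (h \o c).
Proof. by apply/matrixP => i j; rewrite !mxE. Qed.

Lemma map_setRow0 (R S : Type) (h : R -> S) n (u : 'I_n.+1 -> R) M :
  map_mx h (setRow0 u M) = setRow0 (h \o u) (map_mx h M).
Proof. by apply/matrixP => i j; rewrite !mxE; case: ifP. Qed.

Lemma setRow0_mulmx (R : pzRingType) n (u : 'I_n.+1 -> R) (M N : 'M[R]_n.+1) :
  setRow0 u M *m N = setRow0 (fun j => \sum_l u l * N l j) (M *m N).
Proof.
apply/matrixP => i j; rewrite !mxE; case: ifP => [/eqP->|i0].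
  by apply: eq_bigr => l _; rewrite mxE eqxx.
by apply: eq_bigr => l _; rewrite mxE i0.
Qed.

Lemma eq_setRow0 (R : Type) n (u v : 'I_n.+1 -> R) (M : 'M[R]_n.+1) :
  u =1 v -> setRow0 u M = setRow0 v M.
Proof. by move=> uv; apply/matrixP => i j; rewrite !mxE uv. Qed.

Definition fourierMx (R : pzRingType) n (z : R) : 'M[R]_n.+1 :=
  Vandermonde n.+1 (\row_j z ^+ j).

Definition circEigen (R : pzRingType) n (c : 'I_n.+1 -> R) (z : R) : R :=
  \sum_m c m * z ^+ m.

Lemma det_fourierMx_neq0 (R : idomainType) n (z : R) :
  n.+1.-primitive_root z -> \det (fourierMx n z) != 0.
Proof.
move=> prim_z; rewrite det_Vandermonde; apply/prodf_neq0 => i _.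
apply/prodf_neq0 => j ij; rewrite !mxE subr_eq0 (eq_prim_root_expr prim_z).
by rewrite !modn_small // (gtn_eqF ij).
Qed.

Lemma circulant_fourierMx (R : comPzRingType) n (c : 'I_n.+1 -> R) (z : R) :
    z ^+ n.+1 = 1 ->
  circulant c *m fourierMx n z
    = fourierMx n z *m diag_mx (\row_j circEigen c (z ^+ j)).
Proof.
move=> zn; apply/matrixP => i j; rewrite mul_mx_diag !mxE mulr_sumr.
rewrite (reindex_inj (addIr i)); apply: eq_bigr => m _.
rewrite !mxE addrK mulrCA /=; congr (_ * _).
by rewrite -exprD -!exprM mulnC exprM expr_mod // -exprM mulnC addnC.
Qed.

Lemma det_circulant (R : idomainType) n (c : 'I_n.+1 -> R) (z : R) :
    n.+1.-primitive_root z ->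
  \det (circulant c) = \prod_(j < n.+1) circEigen c (z ^+ j).
Proof.
move=> prim_z; apply: (mulIf (det_fourierMx_neq0 prim_z)).
rewrite -det_mulmx circulant_fourierMx ?prim_expr_order // det_mulmx mulrC.
by rewrite det_diag; congr (_ * _); apply: eq_bigr => j _; rewrite mxE.
Qed.

(** Replacing the first row by ones removes the eigenvalue at 1, and the formula
holds even when that eigenvalue is 0. *)
Lemma det_circulant_row1 (R : idomainType) n (c : 'I_n.+1 -> R) (z : R) :
    n.+1.-primitive_root z ->
  \det (setRow0 (fun=> 1) (circulant c))
    = \prod_(j < n.+1 | j != ord0) circEigen c (z ^+ j).
Proof.
move=> prim_z; have zn := prim_expr_order prim_z.
set F := fourierMx n z.
(* The first row of [setRow0 1 M *m F] holds the column sums of F, which vanish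
   except in column 0, where every entry of F is 1. *)
have det_row1 (M : 'M[R]_n.+1) : \det (setRow0 (fun=> 1) M) * \det F
    = n.+1%:R * cofactor (M *m F) ord0 ord0.
  rewrite -det_mulmx setRow0_mulmx det_setRow0 (bigD1 ord0) //=.
  rewrite [X in _ + X]big1 => [|j j0].
    rewrite addr0; congr (_ * _); under eq_bigr do rewrite !mxE expr1n mulr1.
    by rewrite sumr_const card_ord.
  apply/eqP; rewrite mulf_eq0; apply/orP; left.
  have zj1 : z ^+ j - 1 != 0.
    by rewrite subr_eq0 (eq_prim_root_expr prim_z j 0) mod0n modn_small.
  rewrite -(inj_eq (mulfI zj1)) mulr0; under eq_bigr do rewrite mul1r !mxE.
  by rewrite -subrX1 exprAC zn expr1n subrr.
apply: (mulIf (det_fourierMx_neq0 prim_z)).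
rewrite det_row1 circulant_fourierMx //.
(* The minor deletes column 0, so the entry [d 0 0] drops out. *)
have cofD (d : 'rV[R]_n.+1) : cofactor (F *m diag_mx d) ord0 ord0
    = (\prod_(j < n.+1 | j != ord0) d 0 j) * cofactor F ord0 ord0.
  rewrite /cofactor mulrCA; congr (_ * _).
  have -> : row' ord0 (col' ord0 (F *m diag_mx d))
      = row' ord0 (col' ord0 F) *m diag_mx (col' ord0 d).
    by apply/matrixP => i j; rewrite !mul_mx_diag !mxE.
  rewrite det_mulmx mulrC det_diag; congr (_ * _).
  rewrite [RHS]big_mkcond [RHS]big_ord_recl /= mul1r.
  by apply: eq_bigr => j _; rewrite mxE.
rewrite cofD mulrCA; congr (_ * _); first by apply: eq_bigr => j _; rewrite mxE.
(* What remains is the same identity for the identity matrix, for which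
   the determinant with first row 1 is 1. *)
rewrite -[F in cofactor F]mul1mx -det_row1 det_setRow0.
rewrite (eq_bigr (fun j => (\adj (1%:M : 'M[R]_n.+1)) j ord0)) => [|j _]; last first.
  by rewrite mul1r mxE.
rewrite adj1 (bigD1 ord0) //= mxE eqxx big1 ?addr0 ?mul1r // => j j0.
by rewrite mxE (negPf j0).
Qed.

Lemma det_circulant_sum (R : idomainType) n (c : 'I_n.+1 -> R) (z : R) :
    n.+1.-primitive_root z ->
  \det (circulant c) = (\sum_i c i) * \det (setRow0 (fun=> 1) (circulant c)).
Proof.
move=> prim_z; rewrite (det_circulant c prim_z) (det_circulant_row1 c prim_z).
rewrite (bigD1 ord0) //= expr0; congr (_ * _).
by apply: eq_bigr => m _; rewrite expr1n mulr1.
Qed.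

Lemma rowBound_circulant (R : realDomainType) n (c : 'I_n.+1 -> R) i :
  rowBound (circulant c i) = rowBound c.
Proof.
rewrite /rowBound /posPart; congr Num.max; rewrite (reindex_inj (addIr i));
  by apply: eq_bigr => j _; rewrite mxE addrK.
Qed.

Lemma rowBound1 (R : realDomainType) n :
  rowBound (fun _ : 'I_n => 1 : R) = n%:R.
Proof.
rewrite /rowBound /posPart !sumr_const !card_ord.
by rewrite (max_r ler01) (@max_l _ _ 0 (-1)) ?oppr_le0 ?ler01 // mul0rn max_l.
Qed.

Lemma norm_det_circulant (R : realDomainType) n (c : 'I_n.+1 -> R) :
  `|\det (circulant c)| <= rowBound c ^+ n.+1.
Proof.
apply: le_trans (norm_det_le_rowBound _) _.
under eq_bigr do rewrite rowBound_circulant.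
by rewrite prodr_const card_ord.
Qed.

Lemma norm_det_circulant_row1 (R : realDomainType) n (c : 'I_n.+1 -> R) :
  `|\det (setRow0 (fun=> 1) (circulant c))| <= n.+1%:R * rowBound c ^+ n.
Proof.
apply: le_trans (norm_det_le_rowBound _) _; rewrite big_ord_recl.
rewrite (eq_rowBound (w := fun=> 1)) => [|j]; last by rewrite mxE eqxx.
rewrite rowBound1 (eq_bigr (fun=> rowBound c)) ?prodr_const ?card_ord // => i _.
rewrite -(rowBound_circulant c (lift ord0 i)).
by apply: eq_rowBound => j; rewrite mxE.
Qed.

(** * The norm of f(zeta) *)

Lemma horner_intr_circEigen (R : nzRingType) n (f : {poly int}) (z : R) :
    (size f <= n.+1)%N ->
  (map_poly intr f).[z] = circEigen (fun i : 'I_n.+1 => (f`_i)%:~R) z.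
Proof.
move=> size_f; rewrite (horner_coef_wide (n := n.+1)).
  by apply: eq_bigr => i _; rewrite coef_map.
exact: leq_trans (size_poly _ _) size_f.
Qed.

(** For n.+1 prime, the indices coprime to n.+1 are the nonzero ones, so the norm
is the product of the eigenvalues of the circulant matrix over [j != ord0]. *)
Lemma absNorm_prim_root (L : splittingFieldType rat) n (z : L) (f : {poly int}) :
    prime n.+1 -> n.+1.-primitive_root z -> (size f <= n.+1)%N ->
  absNorm <<1; z>>%VS (map_poly intr f).[z]
    = (\det (setRow0 (fun=> 1) (circulant (fun i : 'I_n.+1 => f`_i))))%:~R.
Proof.
move=> n_prime prim_z size_f.
have f1 : map_poly intr f \is a polyOver (1%VS : {vspace L}).
  by apply/polyOverP => i; rewrite coef_map rpred_int.
have galE := galois_prim_root prim_z.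
apply: (fmorph_inj (in_alg L)); rewrite /= absNormE //; last first.
  by apply: rpred_horner; [apply: polyOverSv f1; apply: subv_adjoin|apply: memv_adjoin].
rewrite (galNorm_prim_root prim_z f1) scaler_int -(det_map_mx intr) map_setRow0.
rewrite map_circulant (eq_setRow0 (v := fun=> 1)) //.
rewrite (det_circulant_row1 _ prim_z); apply: eq_big => [j|j _]; last first.
  exact: horner_intr_circEigen.
by rewrite coprime_sym prime_coprime // /dvdn modn_small // -val_eqE.
Qed.

Theorem corollary3p4 (k : nat) (k_prime : prime k)
    (L : splittingFieldType rat) (zeta : L)
    (zeta_prim : k.-primitive_root zeta)
    (f : {poly int}) (size_f : (size f <= k)%N) :
  let N : rat := absNorm <<1; zeta>>%VS (map_poly intr f).[zeta] in
  let A : rat := (maxSum k f)%:~R in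
  let S : int := \sum_(i < k) f`_i in
  (S = 0 -> `|N| <= k%:R * A ^+ k.-1) /\
  (S <> 0 -> `|N| <= A ^+ k / `|S%:~R|).
Proof.
case: k k_prime zeta_prim size_f => // n n_prime zeta_prim size_f N A S.
pose c (i : 'I_n.+1) := f`_i.
have NE := absNorm_prim_root n_prime zeta_prim size_f.
(* The identity holds in Z because it holds in L, which contains a primitive
   root of unity. *)
have detC : \det (circulant c) = S * \det (setRow0 (fun=> 1) (circulant c)).
  apply: (intr_inj (R := rat)); apply: (fmorph_inj (in_alg L)).
  rewrite /= !scaler_int.
  rewrite intrM -!(det_map_mx intr) map_setRow0 map_circulant.
  rewrite (eq_setRow0 (v := fun=> 1)) // (det_circulant_sum _ zeta_prim).
  by rewrite /S rmorph_sum.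
rewrite /N NE /A (_ : maxSum n.+1 f = rowBound c) //; split=> [_|/eqP S0].
  have := norm_det_circulant_row1 c.
  by rewrite -(ler_int rat) intr_norm intrM rmorphXn /= natz -pmulrn.
rewrite ler_pdivlMr ?normr_gt0 ?intr_eq0 // mulrC -normrM -intrM -detC.
by rewrite -intr_norm -rmorphXn ler_int norm_det_circulant.
Qed.
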